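(* Let $f(x,y) = Cx^2 + Dy^2$ with $C, D \in \mathbb{Q}$ nonzero. Then $f$ has a rational periodic vector of type $(L,L,L)$ if and only if there exist rational numbers $\tau, n$ with $\tau \notin \{-1, 0\}$ and $n \neq 0$ such that $$CD = -\frac{\tau^6+2\tau^5+4\tau^4+8\tau^3 + 9\tau^2+4\tau+1}{4 n^2 \tau^2(\tau+1)^2}.$$ In this case, for each such pair $(\tau, n)$ there are three rational periodic vectors $(x,y)$ of type $(L,L,L)$ for $f$ with $y = n$, which are cyclically permuted by $f_L$.
   Context: For $f : \mathbb{Q}^2 \to \mathbb{Q}$ define $f_L : \mathbb{Q}^2 \to \mathbb{Q}^2$ by $f_L(x,y) = (f(x,y), y)$. A rational periodic vector of type $(L,L,L)$ for $f$ is a vector $\overline{v} \in \mathbb{Q}^2$ with $f_L(f_L(f_L(\overline{v}))) = \overline{v}$, $f_L(\overline{v}) \neq \overline{v}$ and $f_L(f_L(\overline{v})) \neq \overline{v}$. *)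

(* Defs.v *)
From HB Require Import structures.
From mathcomp Require Import all_boot all_order all_algebra.

Set Implicit Arguments.
Unset Strict Implicit.
Unset Printing Implicit Defensive.

Import Order.TTheory GRing.Theory Num.Theory.
Local Open Scope ring_scope.

Definition mapL (f : rat * rat -> rat) (v : rat * rat) : rat * rat :=
  (f v, v.2).

Definition periodic_LLL (f : rat * rat -> rat) (v : rat * rat) : Prop :=
  [/\ mapL f (mapL f (mapL f v)) = v,
      mapL f v <> v
    & mapL f (mapL f v) <> v].

Definition diag_quad (C D : rat) (v : rat * rat) : rat :=
  C * v.1 ^+ 2 + D * v.2 ^+ 2.

Definition admissible (C D tau n : rat) : Prop :=
  [/\ tau != -1, tau != 0, n != 0
    & C * D =
      - ((tau ^+ 6 + 2 * tau ^+ 5 + 4 * tau ^+ 4 + 8 * tau ^+ 3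
          + 9 * tau ^+ 2 + 4 * tau + 1)
         / (4 * n ^+ 2 * tau ^+ 2 * (tau + 1) ^+ 2))].

(* Main.v *)
Require Import Defs.
From mathcomp Require Import all_boot all_order all_algebra.
From mathcomp Require Import ring lra.

(** The second coordinate [n] of a vector is fixed by [f_L], and the
    substitution [z = C x] turns the action of [f_L] on the line [y = n] into
    the quadratic map [z |-> z^2 + c] with [c = C D n^2].  So the statement is
    about 3-cycles of quadratic polynomials over the rationals.

    If [z1 |-> z2 |-> z3 |-> z1] is such a cycle, subtracting consecutive
    equations gives [z2 - z3 = (z1 - z2) (z1 + z2)] and its rotations.  Put
    [t = z1 + z2] and [s = z2 + z3]: the three differences are [a], [a t] and
    [a t s] with [a != 0], and they sum to zero, so [1 + t + t s = 0], that is
    [s = - (t + 1) / t].  Hence the three sums of consecutive points are [t]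
    and its images under the Moebius map [rot3 t = - (t + 1) / t] of order
    three.  These sums determine [z1] ([cycle_pt t]), and then
    [c = z2 - z1^2] is a rational function of [t] ([cycle_const t])
    (lemma [three_cycle_param]).

    Conversely, [cycle_const] is invariant under [rot3], and the quadratic map
    with that constant sends [cycle_pt t] to [cycle_pt (rot3 t)]; since [rot3]
    has order three, this is a 3-cycle, and it does not collapse because
    consecutive points differ by a nonzero multiple of [t^2 + t + 1 > 0].

    A periodic vector on the line [n = 0] would force [c = 0], whereas
    [cycle_const t] is always negative ([cycle_const_lt0]): up to the sign, its
    numerator is a sum of squares. *)

Set Implicit Arguments.
Unset Strict Implicit.
Unset Printing Implicit Defensive.

Import Order.TTheory GRing.Theory Num.Theory.
Local Open Scope ring_scope.

(** * Three-cycles of quadratic polynomials *)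

Section ThreeCycles.
Variable R : realFieldType.
Implicit Types c t z : R.

Definition rot3 t : R := - (t + 1) / t.

(** Half of [t - rot3 t + rot3 (rot3 t)]: the point [z1] recovered from the
    sums [z1 + z2], [z2 + z3], [z3 + z1]. *)
Definition cycle_pt t : R :=
  (t ^+ 3 + 2 * t ^+ 2 + t + 1) / (2 * t * (t + 1)).

Definition cycle_const t : R :=
  - ((t ^+ 6 + 2 * t ^+ 5 + 4 * t ^+ 4 + 8 * t ^+ 3 + 9 * t ^+ 2 + 4 * t + 1)
     / (4 * t ^+ 2 * (t + 1) ^+ 2)).

Lemma rot3_neq0 t : t != 0 -> t + 1 != 0 -> rot3 t != 0.
Proof. by move=> t0 t1; rewrite mulf_neq0 ?invr_eq0 ?oppr_eq0. Qed.

Lemma rot3D1 t : t != 0 -> rot3 t + 1 = - t^-1.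
Proof. by move=> t0; rewrite /rot3; field. Qed.

Lemma rot3D1_neq0 t : t != 0 -> rot3 t + 1 != 0.
Proof. by move=> t0; rewrite rot3D1 // oppr_eq0 invr_eq0. Qed.

Lemma rot3_order3 t : t != 0 -> t + 1 != 0 -> rot3 (rot3 (rot3 t)) = t.
Proof.
move=> t0 t1.
have -> : rot3 (rot3 t) = - (t + 1)^-1.
  by rewrite {1}/rot3 rot3D1 // /rot3; field; rewrite t0 t1.
by rewrite /rot3; field.
Qed.

Lemma cycle_const_rot3 t : t != 0 -> t + 1 != 0 ->
  cycle_const (rot3 t) = cycle_const t.
Proof.
move=> t0 t1; rewrite /cycle_const rot3D1 // /rot3; field.
by rewrite t0 t1.
Qed.

Lemma cycle_pt_step t : t != 0 -> t + 1 != 0 ->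
  cycle_pt t ^+ 2 + cycle_const t = cycle_pt (rot3 t).
Proof.
move=> t0 t1; rewrite /cycle_const /cycle_pt rot3D1 // /rot3; field.
by rewrite t0 t1.
Qed.

Lemma cycle_pt_rot3_neq t : t != 0 -> t + 1 != 0 ->
  cycle_pt (rot3 t) != cycle_pt t.
Proof.
move=> t0 t1; rewrite eq_sym -subr_eq0.
have -> : cycle_pt t - cycle_pt (rot3 t) = (t ^+ 2 + t + 1) / (t * (t + 1)).
  rewrite /cycle_pt rot3D1 // /rot3; field.
  by rewrite t0 t1.
rewrite mulf_neq0 ?invr_eq0 ?mulf_neq0 //.
have : 0 < t ^+ 2 + t + 1 by nra.
exact: lt0r_neq0.
Qed.

(** This excludes the line [n = 0], on which the constant is zero. *)
Lemma cycle_const_lt0 t : t != 0 -> t + 1 != 0 -> cycle_const t < 0.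
Proof.
move=> t0 t1; rewrite oppr_lt0 divr_gt0 //; last first.
  by rewrite mulr_gt0 ?exprn_even_gt0 // mulr_gt0 ?exprn_even_gt0.
(* Completing squares from both ends of the sextic leaves [t^2] times a quadratic;
   the coefficient [3 / 2] is chosen to make its discriminant negative. *)
have -> : t ^+ 6 + 2 * t ^+ 5 + 4 * t ^+ 4 + 8 * t ^+ 3 + 9 * t ^+ 2 + 4 * t + 1
  = (t ^+ 3 + t ^+ 2) ^+ 2 + (3 / 2 * t ^+ 2 + 2 * t + 1) ^+ 2
    + t ^+ 2 * (3 / 4 * t ^+ 2 + 2 * t + 2) by field.
apply: ltr_wpDl; first by rewrite addr_ge0 ?sqr_ge0.
rewrite mulr_gt0 ?exprn_even_gt0 //.
by have := sqr_ge0 (3 * t + 4); lra.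
Qed.

(** Every 3-cycle comes from the parameter [t = z1 + z2]: with
    [a = z1 - z2], the differences [a], [a t], [a t (z2 + z3)] of consecutive
    points sum to zero, which expresses [z2 + z3], and then [z1], in terms
    of [t]. *)
Lemma three_cycle_param c z1 z2 z3 :
    z2 = z1 ^+ 2 + c -> z3 = z2 ^+ 2 + c -> z1 = z3 ^+ 2 + c ->
    z2 != z1 -> z3 != z1 ->
  [/\ z1 + z2 != 0, z1 + z2 + 1 != 0 & c = cycle_const (z1 + z2)].
Proof.
move=> e2 e3 e1 n21 n31.
set t := z1 + z2; pose s := z2 + z3.
have d23 : z2 - z3 = (z1 - z2) * t by rewrite /t; lra.
have d31 : z3 - z1 = (z1 - z2) * t * s by rewrite -d23 /s; lra.
have a0 : z1 - z2 != 0 by rewrite subr_eq0 eq_sym.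
have t0 : t != 0.
  by apply: contraNneq n31 => t0; move: d31; rewrite t0 mulr0 mul0r => /eqP;
     rewrite subr_eq0.
have s_rel : 1 + t + t * s = 0.
  apply: (mulfI a0); rewrite mulr0.
  transitivity (z1 - z2 + (z1 - z2) * t + (z1 - z2) * t * s); first by ring.
  by rewrite -d31 -d23; ring.
have t1 : t + 1 != 0.
  apply: contraNneq n31 => t1.
  have /eqP : t * s = 0 by lra.
  rewrite mulf_eq0 (negPf t0) /= => /eqP s0.
  by move: d31; rewrite s0 mulr0 => /eqP; rewrite subr_eq0.
have sE : s = rot3 t.
  by apply: (mulfI t0); rewrite /rot3 mulrCA divff // mulr1; lra.
(* The sum [z3 + z1] is the third image of [t], since the product of the three
   sums of consecutive points is one. *)
have uE : z3 + z1 = - (t + 1)^-1.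
  have a_prod : (z1 - z2) * (t * s * (z3 + z1)) = (z1 - z2) * 1.
    by rewrite !mulrA -d31; lra.
  have p1 := mulfI a0 a_prod.
  have ts : t * s = - (t + 1) by lra.
  by apply: (mulfI t1); rewrite mulrN divff //; move: p1; rewrite ts; lra.
have z1E : z1 = cycle_pt t.
  have -> : z1 = (t - s + (z3 + z1)) / 2 by rewrite /t /s; field.
  by rewrite uE sE /rot3 /cycle_pt; field; rewrite t0 t1.
split=> //.
have -> : c = t - z1 - z1 ^+ 2 by rewrite /t; lra.
by rewrite z1E /cycle_pt /cycle_const; field; rewrite t0 t1.
Qed.

End ThreeCycles.

(** * From quadratic polynomials to periodic vectors *)

Lemma admissibleP (C D tau n : rat) :
  admissible C D tau n <->
  [/\ tau != 0, tau + 1 != 0, n != 0 & C * D * n ^+ 2 = cycle_const tau].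
Proof.
rewrite /admissible -(addr_eq0 tau 1); split; case.
  move=> t1 t0 n0 ->; split=> //.
  by rewrite /cycle_const; field; rewrite t0 t1 n0.
move=> t0 t1 n0 e; split=> //.
have n20 : n ^+ 2 != 0 by rewrite expf_neq0.
apply: (mulIf n20); rewrite e /cycle_const.
by field; rewrite t0 t1 n0.
Qed.

Lemma admissible_rot3 (C D tau n : rat) :
  admissible C D tau n -> admissible C D (rot3 tau) n.
Proof.
case/admissibleP=> t0 t1 n0 e; apply/admissibleP.
by rewrite cycle_const_rot3 // rot3_neq0 // rot3D1_neq0.
Qed.

Section CycleVectors.
Variables C D : rat.
Hypothesis hC : C != 0.

Definition cycle_vec (n tau : rat) : rat * rat := (cycle_pt tau / C, n).

Lemma mapL_cycle_vec tau n : admissible C D tau n ->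
  mapL (diag_quad C D) (cycle_vec n tau) = cycle_vec n (rot3 tau).
Proof.
case/admissibleP=> t0 t1 n0 e.
rewrite /mapL /diag_quad /cycle_vec /= -cycle_pt_step // -e.
by congr (_, _); field.
Qed.

Lemma cycle_vec_rot3_neq tau n : admissible C D tau n ->
  cycle_vec n (rot3 tau) != cycle_vec n tau.
Proof.
case/admissibleP=> t0 t1 _ _; rewrite xpair_eqE eqxx andbT.
by rewrite (inj_eq (mulIf _)) ?invr_eq0 // cycle_pt_rot3_neq.
Qed.

Lemma cycle_vec_rot3_order3 tau n : admissible C D tau n ->
  cycle_vec n (rot3 (rot3 (rot3 tau))) = cycle_vec n tau.
Proof. by case/admissibleP=> t0 t1 _ _; rewrite rot3_order3. Qed.

(** The second iterate is handled by rotating once more: its own image is the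
    starting vector. *)
Lemma cycle_vec_rot3_rot3_neq tau n : admissible C D tau n ->
  cycle_vec n (rot3 (rot3 tau)) != cycle_vec n tau.
Proof.
move=> adm; rewrite eq_sym -(cycle_vec_rot3_order3 adm).
exact/cycle_vec_rot3_neq/admissible_rot3/admissible_rot3.
Qed.

Lemma cycle_vec_periodic tau n : admissible C D tau n ->
  periodic_LLL (diag_quad C D) (cycle_vec n tau).
Proof.
move=> adm; have adm1 := admissible_rot3 adm; have adm2 := admissible_rot3 adm1.
rewrite /periodic_LLL !mapL_cycle_vec // cycle_vec_rot3_order3 //.
by split=> //; apply/eqP; rewrite ?cycle_vec_rot3_neq ?cycle_vec_rot3_rot3_neq.
Qed.

Lemma periodic_LLL_admissible v :
  periodic_LLL (diag_quad C D) v -> exists tau n, admissible C D tau n.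
Proof.
case: v => x n; rewrite /periodic_LLL /mapL /=.
set y := diag_quad C D (x, n); set z := diag_quad C D (y, n).
case=> -[ex] nyx nzx.
have C_inj a b : C * a = C * b -> a = b by apply: mulfI.
have step a : C * diag_quad C D (a, n) = (C * a) ^+ 2 + C * D * n ^+ 2.
  by rewrite /diag_quad /=; ring.
have [] := @three_cycle_param _ (C * D * n ^+ 2) (C * x) (C * y) (C * z).
- exact: step.
- exact: step.
- by rewrite -step ex.
- by apply/eqP => /C_inj e; case: nyx; rewrite e.
- by apply/eqP => /C_inj e; case: nzx; rewrite e.
set t := C * x + C * y => t0 t1 e; exists t, n; apply/admissibleP; split=> //.
apply: contraTneq (cycle_const_lt0 t0 t1) => n0.
by rewrite -e n0 expr0n mulr0 ltxx.
Qed.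

End CycleVectors.

Theorem proposition3p7 (C D : rat) (hC : C != 0) (hD : D != 0) :
  ((exists v : rat * rat, periodic_LLL (diag_quad C D) v) <->
   (exists tau n : rat, admissible C D tau n))
  /\
  (forall tau n : rat, admissible C D tau n ->
     exists v1 v2 v3 : rat * rat,
       [/\ uniq [:: v1; v2; v3],
           (forall v, v \in [:: v1; v2; v3] ->
              periodic_LLL (diag_quad C D) v /\ v.2 = n),
           mapL (diag_quad C D) v1 = v2,
           mapL (diag_quad C D) v2 = v3
         & mapL (diag_quad C D) v3 = v1]).
Proof.
split; first split.
- by case=> v; apply: periodic_LLL_admissible.
- by case=> tau [n adm]; exists (cycle_vec C n tau); apply: cycle_vec_periodic.
move=> tau n adm; have adm1 := admissible_rot3 adm.
have adm2 := admissible_rot3 adm1.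
exists (cycle_vec C n tau), (cycle_vec C n (rot3 tau)),
  (cycle_vec C n (rot3 (rot3 tau))); split.
- rewrite /= !inE negb_or !(eq_sym (cycle_vec C n tau)).
  rewrite (eq_sym (cycle_vec C n (rot3 tau)) (cycle_vec C n (rot3 (rot3 tau)))).
  by rewrite (cycle_vec_rot3_neq hC adm) (cycle_vec_rot3_rot3_neq hC adm)
             (cycle_vec_rot3_neq hC adm1).
- move=> v; rewrite !inE => /or3P[]/eqP->; split=> //;
  exact: cycle_vec_periodic.
- exact: mapL_cycle_vec.
- exact: mapL_cycle_vec.
- by rewrite (mapL_cycle_vec hC adm2) (cycle_vec_rot3_order3 adm).
Qed.
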